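(* Let $(\rho_n)_n$ be a sequence of reals bounded between two positive constants, and let $0<g<1$ and $a,c\ge 0$ be constants such that $e^{-\rho_n}+ag<1$. For each $n$ consider a homogeneous rumor spreading process on $n$ nodes with success probabilities $p_k$ and covariance numbers $c_k$, and suppose that for all sufficiently large $n$ and all integers $u$ with $1\le u\le gn$, (i) $1-p_{n-u}\le e^{-\rho_n}+a\frac{u}{n}$, and (ii) $c_{n-u}\le \frac{c}{u}$. Then there are constants $A',\alpha'>0$ such that $\mathbb{E}[T(n-\lfloor gn\rfloor,n)]\le \frac{1}{\rho_n}\ln n+O(1)$, and $\Pr[T(n-\lfloor gn\rfloor,n)>\frac1{\rho_n}\ln n+r]\le A'e^{-\alpha' r}$ for all $r\in\mathbb{N}$.
   Context: Homogeneous rumor spreading process on $n$ nodes: time proceeds in rounds $1,2,\dots$. Each node is informed or uninformed; informed nodes stay informed; the process starts with exactly one informed node. The process is memoryless: the events in a round depend only on which nodes are informed at the beginning of that round. Moreover, in any round starting with exactly $k$ informed nodes, each uninformed node becomes informed in that round with probability exactly $p_k$, a number depending only on $k$ (and on the process and $n$). The covariance number $c_k$ ($1\le k\le n-1$) is the smallest number such that, whenever a round starts with $k$ informed nodes, for any two uninformed nodes $x_1,x_2$ (distinct) the indicator random variables $X_1,X_2$ of the events that these nodes become informed in this round satisfy $\mathrm{Cov}[X_1,X_2]\le c_k$. $T(k,m)$ (with $k\le m\le n$) denotes the number of rounds it takes, starting from a moment at which exactly $k$ nodes are informed, until at least $m$ nodes are informed. One has one process for each $n$; the asymptotic statements are for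 $n\to\infty$, with $O(1)$ denoting a quantity bounded in absolute value by a constant independent of $n$.
   Formalization: The condition e^{-ρ_n}+ag<1 is required uniformly in n: there is q<1 with e^{-ρ_n}+ag≤q for all n. With the inequality only for each n the claim fails, e.g. g=1/2, a=1, c=0, e^{-ρ_n}=1/2−1/n with independent nodes. *)

(* Defs.v *)
From HB Require Import structures.
From mathcomp Require Export all_boot all_order all_algebra.
From mathcomp Require Export all_classical all_reals all_analysis.

Set Implicit Arguments.
Unset Strict Implicit.
Unset Printing Implicit Defensive.

Import Order.TTheory GRing.Theory Num.Theory.

Local Open Scope classical_set_scope.
Local Open Scope ring_scope.

(* Sets of informed nodes, with the discrete sigma-algebra.  This is an alias
   of {set 'I_n} so that the measurable structure is attached to the alias. *)
Definition informed (n : nat) : Type := {set 'I_n}.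

HB.instance Definition _ n := Finite.copy (informed n) {set 'I_n}.
HB.instance Definition _ n := isPointed.Build (informed n) finset.set0.
HB.instance Definition _ n := @isMeasurable.Build default_measure_display
  (informed n) discrete_measurable discrete_measurable0
  discrete_measurableC discrete_measurableU.

(* [round_law S] is the law of the set of nodes informed at the end of a round
   that starts with exactly the nodes of [S] informed; that it is a function of
   [S] alone is memorylessness.  Only the values [success_prob k] with
   1 <= k <= n - 1 are constrained, and they are determined by [round_law]. *)
Record rumor_process (R : realType) (n : nat) := RumorProcess {
  round_law : informed n -> probability (informed n) R;
  success_prob : nat -> R;
  stays_informed : forall S : informed n,
    round_law S [set S' : informed n | S \subset S'] = 1%E;
  homogeneous : forall (S : informed n) (x : 'I_n),
    (0 < #|S|)%N -> x \notin S ->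
    round_law S [set S' : informed n | x \in S'] = (success_prob #|S|)%:E
}.

(* The smallest upper bound on the covariances of the indicators of "x1 becomes
   informed" and "x2 becomes informed" in a round starting with k informed
   nodes.  For k = n - 1 there is no pair of distinct uninformed nodes and the
   value is -oo. *)
Definition covariance_number (R : realType) (n : nat)
    (proc : rumor_process R n) (k : nat) : \bar R :=
  ereal_sup [set v : \bar R | exists (S : informed n) (x1 x2 : 'I_n),
    [/\ #|S| = k, x1 \notin S, x2 \notin S, x1 != x2 &
        v = covariance (round_law proc S)
              (\1_[set S' : informed n | x1 \in S'])
              (\1_[set S' : informed n | x2 \in S'])]].

(* [X t] is the set of informed nodes after t rounds, counted from a moment at
   which exactly k nodes are informed; the joint law of the [X t] is that of the
   Markov chain with transition probabilities [round_law proc].  The complete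
   process, started with a single informed node, is the case k = 1. *)
Record run_from (R : realType) (n : nat) (proc : rumor_process R n) (k : nat)
    (d : measure_display) (Omega : measurableType d) (P : probability Omega R)
    (X : nat -> {RV P >-> informed n}) : Prop := RunFrom {
  run_start : P [set w | #|X 0%N w| = k] = 1%E;
  run_markov : forall (t : nat) (s : nat -> informed n),
    P [set w | forall i : nat, (i <= t.+1)%N -> X i w = s i] =
    (P [set w | forall i : nat, (i <= t)%N -> X i w = s i] *
     round_law proc (s t) [set s t.+1])%E
}.

(* The first t with at least m nodes informed after t rounds; +oo if there is
   none.  Along a run from k informed nodes this is T(k, m). *)
Definition spreading_time (R : realType) (n : nat) (T : Type)
    (X : nat -> T -> informed n) (m : nat) (w : T) : \bar R :=
  ereal_inf [set (t%:R)%:E | t in [set t : nat | (m <= #|X t w|)%N]].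

(* Main.v *)
Require Import Defs.
From mathcomp Require Import all_boot all_order all_algebra.
From mathcomp Require Import all_classical all_reals all_analysis.
From mathcomp Require Import measurable_realfun ring lra.

(* Let x be the fraction of uninformed nodes.  The mean of its next value is at
   most x (e^-rho + a x), and the variance is at most (1 + c) x / n by the
   covariance hypothesis.  For kap = a e^hi / (1 - q), with hi an upper bound
   on rho, the potential h(x) = x e^(kap x) absorbs the quadratic term: its
   expectation is multiplied by at most e^-rho + D / n in every round.  As h is
   at least 1 / n while some node is uninformed, Markov's inequality bounds the
   probability of not being done after t rounds by
   n (e^-rho + D / n)^t e^kap, and ln n / rho rounds bring this down to O(1)
   before it decays geometrically. *)

Set Implicit Arguments.
Unset Strict Implicit.
Unset Printing Implicit Defensive.

Import Order.TTheory GRing.Theory Num.Theory.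

Local Open Scope classical_set_scope.
Local Open Scope ring_scope.

(** * Exponential estimates for the potential *)

(** From [1 - z <= expR (- z)] comes [expR z - 1 <= z * expR z], hence
    [expR z - 1 - z <= z * (expR z - 1)]. The last factor is compared with [z * expR z] for
    [z >= 0], and with [z] for [z < 0]. *)
Lemma expR_le_quadratic (R : realType) (M z : R) :
  `|z| <= M -> expR z <= 1 + z + expR M * z ^+ 2.
Proof.
move=> zM; have expN : expR z - 1 <= z * expR z.
  have := expR_ge1Dx (- z); rewrite -(ler_pM2l (expR_gt0 z)) -expRD subrr expR0.
  by lra.
have M1 : 1 <= expR M.
  by apply: le_trans (expR_ge1Dx M); rewrite lerDl (le_trans (normr_ge0 z)).
have [z0|z0] := leP 0 z.
  have zeM : expR z <= expR M by rewrite ler_expR (le_trans (ler_norm z)).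
  have : z * (expR z - 1) <= z * (z * expR z) by rewrite ler_wpM2l.
  have : z * z * expR z <= z * z * expR M by rewrite ler_wpM2l // mulr_ge0.
  by nra.
have := expR_ge1Dx z.
have : z ^+ 2 <= expR M * z ^+ 2 by rewrite ler_peMl // sqr_ge0.
by nra.
Qed.

Section finite_law.
Variables (R : realType) (T : finType) (w : T -> R).
Hypotheses (w_ge0 : forall i, 0 <= w i) (w_sum1 : \sum_i w i = 1).

(** Second-order expansion around the mean [m]: the linear term averages to zero, so only the
    variance is added to the potential of the mean. *)
Lemma mean_potential_le (Y : T -> R) (kap m : R) :
    0 <= kap -> (forall i, 0 <= Y i <= 1) -> m = \sum_i w i * Y i ->
  \sum_i w i * (Y i * expR (kap * Y i)) <=
  expR (kap * m) *
    (m + (kap + kap ^+ 2 * expR kap) * \sum_i w i * (Y i - m) ^+ 2).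
Proof.
move=> kap0 Y01 mE.
have m01 : 0 <= m <= 1.
  rewrite mE sumr_ge0 => [/=|i _]; last by rewrite mulr_ge0 //; case/andP: (Y01 i).
  by rewrite -w_sum1; apply: ler_sum => i _; rewrite ler_piMr //; case/andP: (Y01 i).
set B := kap + _.
(* Put [d = Y i - m]. The product [Y i * (kap * d)] contributes [kap * d ^+ 2], and the remainder of
   the exponential contributes [kap ^+ 2 * expR kap * d ^+ 2] because [Y i <= 1]. This is where [B]
   comes from. *)
have pointwise i : Y i * expR (kap * Y i) <=
    expR (kap * m) * (m + (1 + kap * m) * (Y i - m) + B * (Y i - m) ^+ 2).
  have -> : kap * Y i = kap * m + kap * (Y i - m) by ring.
  rewrite expRD mulrCA ler_pM2l ?expR_gt0 //.
  have /andP[Yi0 Yi1] := Y01 i; have /andP[m0 m1] := m01.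
  have dK : `|kap * (Y i - m)| <= kap.
    rewrite normrM (ger0_norm kap0) ler_piMr // ler_norml; lra.
  apply: le_trans (ler_wpM2l Yi0 (expR_le_quadratic dK)) _.
  have : Y i * (expR kap * (kap * (Y i - m)) ^+ 2) <=
         expR kap * (kap * (Y i - m)) ^+ 2.
    by rewrite ler_piMl // mulr_ge0 ?sqr_ge0 ?expR_ge0.
  by rewrite /B; lra.
apply: (@le_trans _ _ (\sum_i w i *
    (expR (kap * m) * (m + (1 + kap * m) * (Y i - m) + B * (Y i - m) ^+ 2)))).
  by apply: ler_sum => i _; rewrite ler_wpM2l.
rewrite le_eqVlt; apply/orP; left; apply/eqP.
have dev0 : \sum_i w i * (Y i - m) = 0.
  under eq_bigr do rewrite mulrBr.
  by rewrite sumrB -mulr_suml w_sum1 mul1r -mE subrr.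
transitivity (\sum_i (expR (kap * m) * m * w i +
    (expR (kap * m) * (1 + kap * m) * (w i * (Y i - m)) +
     expR (kap * m) * B * (w i * (Y i - m) ^+ 2)))).
  by apply: eq_bigr => i _; ring.
rewrite !big_split /= -!mulr_sumr w_sum1 dev0; ring.
Qed.

End finite_law.

(* [x (s + a x)] bounds the mean of the next uninformed fraction, and
   [x * expR (kap * x)] contracts by [s] along this map: the factor
   [1 + a x / s <= expR (b x)] lost to the quadratic term is regained because
   the exponent shrinks by [kap (1 - q) x = b x]. *)
Lemma potential_contracts (R : realType) (a b s q kap x m : R) :
    0 <= a -> 0 < s -> q < 1 -> a <= b * s -> kap * (1 - q) = b -> 0 <= kap ->
    0 <= x -> s + a * x <= q -> 0 <= m -> m <= x * (s + a * x) ->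
  m * expR (kap * m) <= s * (x * expR (kap * x)).
Proof.
move=> a0 s0 q1 abs kapE kap0 x0 sq m0 mx.
have mqx : m <= q * x by apply: (le_trans mx); rewrite mulrC ler_wpM2r.
have e1 : expR (kap * m) <= expR (kap * (q * x)).
  by rewrite ler_expR ler_wpM2l.
have e2 : m <= s * x * expR (b * x).
  apply: (le_trans mx); apply: (@le_trans _ _ (s * x * (1 + b * x))).
    have : a * (x * x) <= b * s * (x * x) by rewrite ler_wpM2r // mulr_ge0.
    by lra.
  by rewrite ler_wpM2l ?expR_ge1Dx // mulr_ge0 // ltW.
apply: (le_trans (ler_pM m0 (expR_ge0 _) e2 e1)).
rewrite -!mulrA -expRD.
by rewrite (_ : b * x + kap * (q * x) = kap * x) // -kapE; ring.
Qed.

(** * Mean and variance of the number of uninformed nodes after one round *)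

Section uninformed_count.
Variables (R : realType) (n : nat) (S : {set 'I_n}) (w : {set 'I_n} -> R).
Variables (Q C : R).
Hypotheses (w_ge0 : forall S', 0 <= w S') (w_sum1 : \sum_(S' : {set 'I_n}) w S' = 1).
Hypothesis w_supp : forall S' : {set 'I_n}, ~~ (S \subset S') -> w S' = 0.
Hypothesis w_miss : forall x, x \notin S ->
  \sum_(S' : {set 'I_n}) w S' * (x \notin S')%:R = Q.
Hypothesis w_miss2 : forall x y, x \notin S -> y \notin S -> x != y ->
  \sum_(S' : {set 'I_n}) w S' * ((x \notin S')%:R * (y \notin S')%:R) <= Q ^+ 2 + C.

Let u : R := #|~: S|%:R.

Lemma uninformedE (S' : {set 'I_n}) : S \subset S' ->
  #|~: S'|%:R = \sum_(x | x \notin S) (x \notin S')%:R :> R.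
Proof.
move=> SS'; rewrite -sum1_card natr_sum big_mkcond [RHS]big_mkcond /=.
apply: eq_bigr => x _; rewrite !inE.
case: (boolP (x \in S)) => [xS|_] /=; first by rewrite (fintype.subsetP SS' _ xS).
by case: (x \in S').
Qed.

Lemma mean_uninformed : \sum_(S' : {set 'I_n}) w S' * #|~: S'|%:R = u * Q.
Proof.
transitivity (\sum_(S' : {set 'I_n}) \sum_(x | x \notin S) w S' * (x \notin S')%:R).
  apply: eq_bigr => S' _; have [SS'|/w_supp ->] := boolP (S \subset S').
    by rewrite uninformedE // mulr_sumr.
  by rewrite mul0r big1 // => x _; rewrite mul0r.
rewrite exchange_big /= (eq_bigr _ w_miss) sumr_const mulr_natl.
by congr (_ *+ _); apply: eq_card => x; rewrite !inE.
Qed.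

(** When every node is informed, [w_miss] is vacuous and [Q] is arbitrary; the node [x] excludes
    this case. *)
Lemma miss_prob_ge0_le1 x : x \notin S -> 0 <= Q <= 1.
Proof.
move=> xS; rewrite -(w_miss xS) sumr_ge0 /= => [|S' _]; last by rewrite mulr_ge0.
rewrite -[leRHS]w_sum1; apply: ler_sum => S' _; by case: (x \in S'); rewrite /= ?mulr1 ?mulr0.
Qed.

(** The squared count is a sum over ordered pairs of uninformed nodes: the [u] diagonal pairs
    contribute [Q] each, the [u * (u - 1)] others at most [Q ^+ 2 + C] each. *)
Lemma second_moment_uninformed :
  \sum_(S' : {set 'I_n}) w S' * #|~: S'|%:R ^+ 2 <= u * Q + u * (u - 1) * (Q ^+ 2 + C).
Proof.
apply: (@le_trans _ _ (\sum_(x | x \notin S)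
   (Q + \sum_(y | (y \notin S) && (y != x)) (Q ^+ 2 + C)))); last first.
  rewrite le_eqVlt; apply/orP; left; apply/eqP.
  transitivity (\sum_(x | x \notin S) (Q + (u - 1) * (Q ^+ 2 + C))).
    apply: eq_bigr => x xS; congr (_ + _); rewrite sumr_const.
    rewrite /u (cardsD1 x) inE xS natrD /= addrAC subrr add0r.
    rewrite mulr_natl; congr (_ *+ _); apply: eq_card => y.
    by rewrite !inE andbC.
  rewrite sumr_const (_ : #|[pred i | i \notin S]| = #|~: S|); last first.
    by apply: eq_card => x; rewrite !inE.
  by rewrite -mulr_natl -/u; ring.
rewrite (_ : \sum_(S' : {set 'I_n}) _ = \sum_(x | x \notin S) \sum_(y | y \notin S)
    \sum_(S' : {set 'I_n}) w S' * ((x \notin S')%:R * (y \notin S')%:R)).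
  apply: ler_sum => x xS; rewrite (bigD1 x) //= lerD //.
    rewrite le_eqVlt -(w_miss xS); apply/orP; left; apply/eqP.
    by apply: eq_bigr => S' _; case: (x \in S'); rewrite /= ?mulr1 ?mulr0.
  by apply: ler_sum => y /andP[yS xy]; apply: w_miss2; rewrite // eq_sym.
transitivity (\sum_(S' : {set 'I_n}) \sum_(x | x \notin S) \sum_(y | y \notin S)
    w S' * ((x \notin S')%:R * (y \notin S')%:R)).
  apply: eq_bigr => S' _; have [SS'|/w_supp ->] := boolP (S \subset S').
    rewrite uninformedE // expr2 mulr_suml mulr_sumr; apply: eq_bigr => x _.
    by rewrite !mulr_sumr.
  by rewrite mul0r big1 // => x _; rewrite big1 // => y _; rewrite mul0r.
by rewrite exchange_big /=; apply: eq_bigr => x _; rewrite exchange_big.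
Qed.

(** The variance is at most [u * (Q - Q ^+ 2) + u * (u - 1) * C]. The assumption [C * u <= c] makes
    the quadratically many covariances cost only [u * c]. *)
Lemma variance_uninformed (c : R) : 0 <= C -> C * u <= c ->
  \sum_(S' : {set 'I_n}) w S' * (#|~: S'|%:R - u * Q) ^+ 2 <= u * (1 + c).
Proof.
move=> C0 Cu; have u0 : 0 <= u by [].
have -> : \sum_(S' : {set 'I_n}) w S' * (#|~: S'|%:R - u * Q) ^+ 2 =
    \sum_(S' : {set 'I_n}) w S' * #|~: S'|%:R ^+ 2 - (u * Q) ^+ 2.
  transitivity (\sum_(S' : {set 'I_n}) (w S' * #|~: S'|%:R ^+ 2 +
     ((- (2 * u * Q)) * (w S' * #|~: S'|%:R) + (u * Q) ^+ 2 * w S'))).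
    by apply: eq_bigr => S' _; ring.
  by rewrite !big_split /= -!mulr_sumr w_sum1 mean_uninformed; ring.
have := second_moment_uninformed.
have uQ : u * (Q - Q ^+ 2) <= u * 1.
  have [E|/set0Pn[x]] := eqVneq (~: S) finset.set0.
    by rewrite /u E cards0 !mul0r.
  rewrite inE => /miss_prob_ge0_le1 /andP[Q0 Q1]; rewrite ler_wpM2l //; nra.
have : u * (C * u) <= u * c by rewrite ler_wpM2l.
have : 0 <= u * C by rewrite mulr_ge0.
by nra.
Qed.

End uninformed_count.

(** * Finite-valued random variables: probabilities as finite sums *)

Lemma total_probability (d : measure_display) (Omega : measurableType d)
    (R : realType) (P : probability Omega R) (F : finType) (Y : Omega -> F)
    (A : set Omega) :
    (forall i, measurable (A `&` [set w | Y w = i])) ->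
  P A = (\sum_i P (A `&` [set w | Y w = i]))%E.
Proof.
move=> mA; rewrite [in LHS](_ : A = \bigcup_(i in setT) (A `&` [set w | Y w = i])).
  rewrite measure_fin_bigcup //; [|exact: finite_finset|]; last first.
    by move=> i j _ _ [w [/= [_ <-] [_ <-]]].
  rewrite [RHS]fsbig_seq ?index_enum_uniq //; apply: eq_fsbigl.
  by apply/seteqP; split => i //= _; rewrite mem_index_enum.
by apply/seteqP; split => [w Aw|w [i _ []] //]; exists (Y w).
Qed.

Lemma prob_finite (d : measure_display) (Omega : measurableType d)
    (R : realType) (P : probability Omega R) (F : finType) (Y : Omega -> F)
    (b : pred F) :
    (forall i, measurable [set w | Y w = i]) ->
  P [set w | b (Y w)] = (\sum_i fine (P [set w | Y w = i]) * (b i)%:R)%:E.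
Proof.
move=> mY; have bE i : [set w | b (Y w)] `&` [set w | Y w = i] =
    if b i then [set w | Y w = i] else set0.
  case: ifP => bi; last by apply/seteqP; split => w // -[/= + wi]; rewrite wi bi.
  by apply/seteqP; split => [w []|w /= wi] //; rewrite /= wi.
rewrite (@total_probability _ _ _ P F Y) => [|i]; last by rewrite bE; case: ifP.
rewrite -sumEFin; apply: eq_bigr => i _; rewrite bE; case: ifP => _.
  by rewrite mulr1 fineK // fin_num_measure.
by rewrite mulr0 measure0.
Qed.

(** * The law of one round as weights on sets of nodes *)

Section one_round.
Variables (R : realType) (n : nat) (proc : rumor_process R n).

Definition round_weight (S S' : informed n) : R :=
  fine (round_law proc S [set S']).

Lemma round_lawE (S : informed n) (b : pred (informed n)) :
  round_law proc S [set S' | b S'] =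
  (\sum_S' round_weight S S' * (b S')%:R)%:E.
Proof. exact: (@prob_finite _ _ _ (round_law proc S) (informed n) id). Qed.

Lemma round_weight_ge0 S S' : 0 <= round_weight S S'.
Proof. exact: fine_ge0. Qed.

Lemma round_weight_sum1 S : \sum_S' round_weight S S' = 1.
Proof.
have := round_lawE S predT.
rewrite (_ : [set _ | _] = setT) ?probability_setT; last by apply/seteqP.
by case=> ->; apply: eq_bigr => S' _; rewrite mulr1.
Qed.

Lemma round_weight_supp (S S' : informed n) :
  ~~ (S \subset S') -> round_weight S S' = 0.
Proof.
move=> SS'; have := stays_informed proc S; rewrite round_lawE => -[stay].
(* The supersets of [S] already carry total mass 1, so the remaining nonnegative weights sum to zero
   and each vanishes. *)
have leave0 : \sum_(T : informed n) round_weight S T * (~~ (S \subset T))%:R = 0.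
  apply: (@addrI _ (\sum_(T : informed n) round_weight S T * (S \subset T)%:R)).
  rewrite addr0 [RHS]stay -big_split -[RHS](round_weight_sum1 S) /=.
  by apply: eq_bigr => T _; case: (S \subset T); rewrite /= ?mulr1 ?mulr0 ?addr0 ?add0r.
have := psumr_eq0P _ leave0 (i := S') isT; rewrite SS' mulr1; apply.
by move=> T _; rewrite mulr_ge0 ?round_weight_ge0.
Qed.

Lemma round_weight_miss (S : informed n) (x : 'I_n) :
    (0 < #|S|)%N -> x \notin S ->
  \sum_S' round_weight S S' * (x \notin S')%:R = 1 - success_prob proc #|S|.
Proof.
move=> S0 xS; have := homogeneous proc S0 xS; rewrite round_lawE => -[<-].
rewrite -[X in X - _](round_weight_sum1 S) -sumrB; apply: eq_bigr => S' _.
by case: (x \in S'); rewrite ?mulr1 ?mulr0 ?subrr ?subr0.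
Qed.

(** Complementing both indicators leaves a covariance unchanged. This carries the hypothesis on
    covariance numbers over to the events of staying uninformed. *)
Lemma round_covarianceE (S : informed n) (x y : 'I_n) :
    (0 < #|S|)%N -> x \notin S -> y \notin S ->
  covariance (round_law proc S) (\1_[set S' : informed n | x \in S'])
    (\1_[set S' : informed n | y \in S']) =
  (\sum_S' round_weight S S' * ((x \notin S')%:R * (y \notin S')%:R)
   - (1 - success_prob proc #|S|) ^+ 2)%:E.
Proof.
move=> S0 xS yS.
have L1 (A : set (informed n)) : \1_A \in Lfun (round_law proc S) 1.
  by apply/Lfun1_integrable; apply: integrable_indic.
have both : \1_[set S' : informed n | x \in S'] * \1_[set S' : informed n | y \in S'] =
    \1_[set S' : informed n | (x \in S') && (y \in S')] :> (informed n -> R).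
  rewrite (_ : [set S' : informed n | (x \in S') && _] =
      [set S' : informed n | x \in S'] `&` [set S' : informed n | y \in S']) ?indicI //.
  by apply/seteqP; split => S' /= => [/andP[]|[-> ->]].
rewrite covarianceE ?both // !expectation_indic //.
rewrite (homogeneous proc S0 xS) (homogeneous proc S0 yS).
rewrite round_lawE -EFinM -EFinB; congr EFin.
set p := success_prob _ _.
(* Inclusion-exclusion: [(1 - X) * (1 - Y) = (1 - X) + (1 - Y) + X * Y - 1]. *)
have E : \sum_S' round_weight S S' * ((x \notin S')%:R * (y \notin S')%:R) =
   \sum_S' round_weight S S' * (x \notin S')%:R +
   \sum_S' round_weight S S' * (y \notin S')%:R +
   \sum_S' round_weight S S' * ((x \in S') && (y \in S'))%:R -
   \sum_S' round_weight S S'.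
  rewrite -!big_split /= -sumrB; apply: eq_bigr => S' _.
  by case: (x \in S'); case: (y \in S') => /=; ring.
by rewrite E !round_weight_miss // round_weight_sum1 -/p; ring.
Qed.

End one_round.

(** * Contraction of the expected potential in one round *)

Section drift.
Variables (R : realType) (n : nat) (proc : rumor_process R n).
Variables (a b s q kap c : R).
Hypotheses (n_gt0 : (0 < n)%N) (a_ge0 : 0 <= a) (c_ge0 : 0 <= c).
Hypotheses (s_gt0 : 0 < s) (q_lt1 : q < 1) (a_le : a <= b * s).
Hypotheses (kapE : kap * (1 - q) = b) (kap_ge0 : 0 <= kap).

Definition uninformed_frac (S : informed n) : R := #|~: S|%:R / n%:R.

Definition potential (S : informed n) : R :=
  uninformed_frac S * expR (kap * uninformed_frac S).

(** The three factors bound [expR (kap * m)] for a mean [m <= 1], give the variance coefficient of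
    [mean_potential_le], and come from [variance_uninformed]. *)
Definition drift_error : R :=
  expR kap * (kap + kap ^+ 2 * expR kap) * (1 + c).

Lemma uninformed_frac_ge0_le1 S : 0 <= uninformed_frac S <= 1.
Proof.
rewrite /uninformed_frac divr_ge0 //= ler_pdivrMr ?ltr0n // mul1r ler_nat.
by rewrite -[leqRHS]card_ord max_card.
Qed.

(** Serves twice: it turns the additive variance error into a multiplicative one, and it keeps the
    potential at least [1 / n] while some node is uninformed. *)
Lemma uninformed_frac_le_potential S : uninformed_frac S <= potential S.
Proof.
have /andP[x0 _] := uninformed_frac_ge0_le1 S.
by rewrite /potential ler_peMr // -expR0 ler_expR mulr_ge0.
Qed.

Lemma potential_ge0 S : 0 <= potential S.
Proof.
by apply: le_trans (uninformed_frac_le_potential S); case/andP: (uninformed_frac_ge0_le1 S).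
Qed.

Lemma potential_le S : potential S <= expR kap.
Proof.
have /andP[x0 x1] := uninformed_frac_ge0_le1 S.
rewrite /potential -[leRHS]mul1r ler_pM ?expR_ge0 // ler_expR.
by rewrite ler_piMr.
Qed.

Lemma potential_drift (S : informed n) :
    (0 < #|S|)%N -> s + a * uninformed_frac S <= q ->
    ((0 < #|~: S|)%N ->
       1 - success_prob proc #|S| <= s + a * uninformed_frac S
       /\ (covariance_number proc #|S| <= (c / #|~: S|%:R)%:E)%E) ->
  \sum_S' round_weight proc S S' * potential S' <=
  (s + drift_error / n%:R) * potential S.
Proof.
(* If all nodes are informed, they stay so and the next potential is 0 wherever the weight is
   nonzero; the bounds on success probability and covariance only concern the other case. *)
move=> S_gt0 sq; case: (posnP #|~: S|) => [/cards0_eq SE _|u_gt0 /(_ isT)[Qle covle]].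
  have S'E S' : round_weight proc S S' * potential S' = 0.
    have [|/round_weight_supp -> ] := boolP (S \subset S'); last exact: mul0r.
    rewrite -finset.setCS SE finset.subset0 => /eqP S'0.
    by rewrite /potential /uninformed_frac S'0 cards0 !mul0r mulr0.
  rewrite big1 // mulr_ge0 ?potential_ge0 // addr_ge0 ?(ltW s_gt0) // divr_ge0 //.
  by rewrite !mulr_ge0 ?expR_ge0 ?addr_ge0 ?mulr_ge0 ?sqr_ge0 ?expR_ge0.
set x := uninformed_frac S in sq Qle *.
set Q := 1 - success_prob proc #|S| in Qle.
set u : R := #|~: S|%:R in covle *.
have n0 : 0 < n%:R :> R by rewrite ltr0n.
have u0 : 0 < u by rewrite ltr0n.
have miss y : y \notin S -> \sum_S' round_weight proc S S' * (y \notin S')%:R = Q.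
  exact: round_weight_miss.
have miss2 y z : y \notin S -> z \notin S -> y != z ->
    \sum_S' round_weight proc S S' * ((y \notin S')%:R * (z \notin S')%:R)
    <= Q ^+ 2 + c / u.
  move=> yS zS yz; rewrite addrC -lerBlDr -lee_fin -round_covarianceE //.
  apply: le_trans covle; apply: ereal_sup_ubound.
  by exists S, y, z.
have w0 := round_weight_ge0 proc S.
have w1 := round_weight_sum1 proc S.
have ws := @round_weight_supp _ _ proc S.
have mean := mean_uninformed ws miss.
have var : \sum_S' round_weight proc S S' * (#|~: S'|%:R - u * Q) ^+ 2 <= u * (1 + c).
  apply: (variance_uninformed w0 w1 ws miss miss2); first by rewrite divr_ge0 // ltW.
  by rewrite divfK // gt_eqF.
have Y01 := uninformed_frac_ge0_le1.
have mE : x * Q = \sum_S' round_weight proc S S' * uninformed_frac S'.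
  under eq_bigr do rewrite /uninformed_frac mulrA.
  by rewrite -mulr_suml mean /x /uninformed_frac -/u; ring.
have := mean_potential_le w0 w1 kap_ge0 Y01 mE.
set V := \sum_S' _ * (_ - x * Q) ^+ 2.
(* Passing from counts to fractions divides the variance by [n ^ 2]; one factor [n] turns [u] into
   [x], the other remains as the gain. *)
have Vle : V <= x * (1 + c) / n%:R.
  have -> : V = (\sum_S' round_weight proc S S' * (#|~: S'|%:R - u * Q) ^+ 2) / n%:R ^+ 2.
    rewrite mulr_suml; apply: eq_bigr => S' _; rewrite /x /uninformed_frac -/u.
    by field; rewrite gt_eqF.
  have -> : x * (1 + c) / n%:R = u * (1 + c) / n%:R ^+ 2.
    by rewrite /x /uninformed_frac -/u; field; rewrite gt_eqF.
  by rewrite ler_wpM2r // invr_ge0 sqr_ge0.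
have /andP[x0 x1] : 0 <= x <= 1 := Y01 S.
have m0 : 0 <= x * Q.
  by rewrite mE sumr_ge0 // => S' _; rewrite mulr_ge0 //; case/andP: (Y01 S').
have mx : x * Q <= x * (s + a * x) by rewrite ler_wpM2l.
have m1 : x * Q <= 1.
  apply: (le_trans mx); rewrite -[leRHS]mulr1 ler_pM //.
    by rewrite addr_ge0 ?mulr_ge0 // ltW.
  by apply: (le_trans sq); rewrite ltW.
have := potential_contracts a_ge0 s_gt0 q_lt1 a_le kapE kap_ge0 x0 sq m0 mx.
rewrite -/(potential S) => contr /le_trans; apply.
rewrite mulrDr [leRHS]mulrDl; apply: lerD; first by rewrite mulrC.
have B0 : 0 <= kap + kap ^+ 2 * expR kap.
  by rewrite addr_ge0 ?mulr_ge0 ?sqr_ge0 ?expR_ge0.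
(* The variance error is proportional to [x], hence to at most the potential of [S], so it only
   perturbs the contraction factor. *)
apply: (@le_trans _ _ (expR kap * ((kap + kap ^+ 2 * expR kap) * (x * (1 + c) / n%:R)))).
  have V0 : 0 <= V by apply: sumr_ge0 => S' _; rewrite mulr_ge0 ?sqr_ge0.
  apply: ler_pM; rewrite ?expR_ge0 ?mulr_ge0 //; first by rewrite ler_expR ler_piMr.
  by rewrite ler_wpM2l.
have -> : expR kap * ((kap + kap ^+ 2 * expR kap) * (x * (1 + c) / n%:R)) =
    drift_error / n%:R * x.
  by rewrite /drift_error; field; rewrite gt_eqF.
rewrite ler_wpM2l ?uninformed_frac_le_potential // divr_ge0 //.
by rewrite /drift_error mulr_ge0 ?addr_ge0 // mulr_ge0 ?expR_ge0.
Qed.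

End drift.

(** * The Markov chain of informed sets and its marginal laws *)

Section run.
Variables (R : realType) (n : nat) (proc : rumor_process R n) (k : nat).
Variables (d : measure_display) (Omega : measurableType d).
Variables (P : probability Omega R) (X : nat -> {RV P >-> informed n}).
Hypothesis run : run_from proc k X.

Lemma measurable_state t (b : pred (informed n)) : measurable [set w | b (X t w)].
Proof.
have := measurable_funP (X t) measurableT [set S | b S].
by rewrite setTI; apply.
Qed.

Lemma measurable_state_eq t (S : informed n) : measurable [set w | X t w = S].
Proof.
have := @measurable_state t (pred1 S).
by rewrite (_ : [set w | pred1 S (X t w)] = [set w | X t w = S])//;
  apply/seteqP; split => w /= /eqP.
Qed.

Let path m t (s : nat -> informed n) : set Omega :=
  [set w | forall i, (m <= i <= t)%N -> X i w = s i].

Lemma measurable_path m t s : measurable (path m t s).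
Proof.
rewrite (_ : path m t s =
    \bigcap_(i in [set i | (m <= i <= t)%N]) [set w | X i w = s i]).
  by apply: bigcap_measurableType => i _; apply: measurable_state_eq.
by apply/seteqP; split.
Qed.

(** [run_markov] speaks of histories from time 0 only. Induction on [m] forgets the earliest time of
    the window by summing over the state there. *)
Lemma path_markov m t s : (m <= t)%N ->
  P (path m t.+1 s) = (P (path m t s) * round_law proc (s t) [set s t.+1])%E.
Proof.
elim: m s => [|m IH] s; first by move=> _; exact: (run_markov run).
(* Fixing the state at time [m] to [S] extends the window back to [m]. Since [m < t], the states at
   [t] and [t.+1], and so the transition factor, do not change. *)
move=> mt; pose upd S i := if i == m then S else s i.
have split_path t' S : (m <= t')%N ->
    path m.+1 t' s `&` [set w | X m w = S] = path m t' (upd S).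
  move=> mt'; apply/seteqP; split=> w.
    move=> [ws wS] i /andP[mi it]; rewrite /upd; case: eqVneq => [->//|im].
    by apply: ws; rewrite it ltn_neqAle eq_sym im mi.
  move=> ws; split=> [i /andP[mi it]|/=].
    by rewrite ws ?it ?(ltnW mi) // /upd gtn_eqF.
  by rewrite ws ?leqnn // /upd eqxx.
have mt1 : (m <= t)%N by apply: ltnW.
rewrite (@total_probability _ _ _ P (informed n) (X m)) => [|S]; last first.
  by apply: measurableI; [apply: measurable_path|apply: measurable_state_eq].
rewrite (@total_probability _ _ _ P (informed n) (X m) (path m.+1 t s)) => [|S]; last first.
  by apply: measurableI; [apply: measurable_path|apply: measurable_state_eq].
rewrite ge0_sume_distrl => [|S _]; last exact: measure_ge0.
apply: eq_bigr => S _; rewrite !split_path ?leqW // IH //.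
by rewrite /upd !gtn_eqF // ltnS.
Qed.

Definition state_law t (S : informed n) : R := fine (P [set w | X t w = S]).

Lemma state_law_ge0 t S : 0 <= state_law t S.
Proof. exact: fine_ge0. Qed.

Lemma prob_stateE t (b : pred (informed n)) :
  P [set w | b (X t w)] = (\sum_S state_law t S * (b S)%:R)%:E.
Proof. by apply: prob_finite => S; apply: measurable_state_eq. Qed.

(** Chapman-Kolmogorov for one step: [path_markov] on the window from [t] to [t.+1], summed over the
    state at [t]. *)
Lemma state_law_step t S' :
  state_law t.+1 S' = \sum_S state_law t S * round_weight proc S S'.
Proof.
rewrite /state_law (@total_probability _ _ _ P (informed n) (X t)) => [|S]; last first.
  by apply: measurableI; apply: measurable_state_eq.
rewrite -[RHS]/(fine (_%:E)) -sumEFin; congr fine; apply: eq_bigr => S _.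
pose s i := if i == t then S else S'.
have := @path_markov t t s (leqnn t).
have -> : path t t s = [set w | X t w = S].
  apply/seteqP; split=> w; first by move/(_ t); rewrite leqnn /s eqxx; apply.
  by move=> wS i; rewrite -eqn_leq => /eqP <-; rewrite /s eqxx.
have -> : path t t.+1 s = [set w | X t.+1 w = S'] `&` [set w | X t w = S].
  apply/seteqP; split=> w.
    move=> ws; split => /=.
      by rewrite ws ?leqnn ?leqnSn // /s gtn_eqF.
    by rewrite ws ?leqnn ?leqnSn // /s eqxx.
  move=> [wS' wS] i /andP[ti]; rewrite leq_eqVlt ltnS => /orP[/eqP ->|it].
    by rewrite /s gtn_eqF.
  by rewrite (_ : i = t) /s ?eqxx //; apply/eqP; rewrite eqn_leq ti it.
rewrite /s eqxx gtn_eqF // => ->.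
by rewrite EFinM !fineK ?fin_num_measure //; apply: measurable_state_eq.
Qed.

Lemma state_law_sum1 t : \sum_S state_law t S = 1.
Proof.
have := prob_stateE t predT.
rewrite (_ : [set _ | _] = setT) ?probability_setT; last by apply/seteqP.
by case=> ->; apply: eq_bigr => S' _; rewrite mulr1.
Qed.

(** Informed sets start with [k] elements and only grow, so a drift inequality is needed only on
    sets of size at least [k]. *)
Lemma state_law_supp t (S : informed n) : (#|S| < k)%N -> state_law t S = 0.
Proof.
elim: t S => [|t IH] S Sk.
  have := prob_stateE 0 (fun S : informed n => #|S| == k).
  rewrite (_ : [set _ | _] = [set w | #|X 0%N w| = k]); last first.
    by apply/seteqP; split => w /= /eqP.
  rewrite (run_start run) => -[start].
  have rest0 : \sum_(S : informed n) state_law 0 S * (#|S| != k)%:R = 0.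
    apply: (@addrI _ (\sum_(S : informed n) state_law 0 S * (#|S| == k)%:R)).
    rewrite addr0 -[RHS]start -big_split -[RHS](state_law_sum1 0) /=.
    by apply: eq_bigr => T _; case: (_ == k); rewrite /= ?mulr1 ?mulr0 ?addr0 ?add0r.
  have := psumr_eq0P _ rest0 (i := S) isT; rewrite ltn_eqF // mulr1; apply.
  by move=> T _; rewrite mulr_ge0 ?state_law_ge0.
rewrite state_law_step big1 // => T _.
have [/IH ->|kT] := ltnP #|T| k; first by rewrite mul0r.
have [/subset_leq_card TS|/round_weight_supp ->] := boolP (T \subset S); last first.
  by rewrite mulr0.
by move: (leq_trans kT TS); rewrite leqNgt Sk.
Qed.

Lemma state_law_drift (f : informed n -> R) (lam : R) t :
    0 <= lam ->
    (forall S : informed n, (k <= #|S|)%N ->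
       \sum_S' round_weight proc S S' * f S' <= lam * f S) ->
  \sum_S state_law t S * f S <= lam ^+ t * \sum_S state_law 0 S * f S.
Proof.
move=> lam0 drift; elim: t => [|t IH]; first by rewrite expr0 mul1r.
rewrite exprS -mulrA; apply: le_trans (ler_wpM2l lam0 IH).
under eq_bigr do rewrite state_law_step mulr_suml.
rewrite exchange_big mulr_sumr /=; apply: ler_sum => S _.
have [/state_law_supp Sk|kS] := ltnP #|S| k.
  by rewrite big1 => [|S' _]; rewrite Sk !mul0r // mulr0.
under eq_bigr do rewrite -mulrA.
by rewrite -mulr_sumr mulrCA ler_wpM2l ?state_law_ge0 ?drift.
Qed.

End run.

(** * From tail bounds to the expectation of the spreading time *)

(** Pathwise form of the tail-sum formula: the series counts the thresholds [tau + r] lying below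
    [v], and these have spacing 1. *)
Lemma le_count_series (R : realType) (v : \bar R) (tau : R) : (0 <= v)%E ->
  (v <= (tau + 1)%:E +
    \sum_(0 <= r <oo) (((tau + r%:R)%:E < v)%E : nat)%:R%:E)%E.
Proof.
move=> v0; set f := fun r : nat => (((tau + r%:R)%:E < v)%E : nat)%:R%:E : \bar R.
have f0 r : (0 <= f r)%E by rewrite lee_fin.
have partial N : ((tau + N%:R)%:E < v)%E -> (N.+1%:R%:E <= \sum_(0 <= r <oo) f r)%E.
  move=> Nv; apply: le_trans (nneseries_lim_ge N.+1 _) => //.
  rewrite (eq_big_nat _ _ (F2 := fun=> 1%E)) => [|r /andP[_ rN]].
    by rewrite sumEFin big_const_nat subn0 iter_addr_0.
  rewrite /f (le_lt_trans _ Nv) // lee_fin lerD2l ler_nat -ltnS //.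
have [vt|] := leP v (tau + 1)%:E.
  by apply: (le_trans vt); rewrite leeDl // nneseries_ge0.
case: v v0 @f f0 partial => [v| |] // v0 f f0 partial; rewrite ?lte_fin => vt.
  pose N := Num.truncn (v - tau - 1).
  have /andP[Nle Nlt] : N%:R <= v - tau - 1 < N.+1%:R by apply: truncn_itv; lra.
  have NS : (N.+1%:R%:E <= \sum_(0 <= r <oo) f r)%E.
    apply: partial; rewrite lte_fin; lra.
  apply: le_trans (leeD2l _ NS); rewrite -EFinD lee_fin; move: Nlt; lra.
(* Only [v = +oo] is left: every threshold is exceeded, so the partial sums pass any real bound. *)
suff -> : (\sum_(0 <= r <oo) f r = +oo)%E by rewrite addey.
apply/eqyP => A A0; apply: le_trans (partial (Num.truncn A) (ltry _)).
by rewrite lee_fin ltW // truncnS_gt.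
Qed.

Lemma geometric_nneseries_le (R : realType) (A z : R) : 0 <= A -> 0 <= z -> z < 1 ->
  (\sum_(0 <= r <oo) (A * z ^+ r)%:E <= (A / (1 - z))%:E)%E.
Proof.
move=> A0 z0 z1; have Az r : (0 <= (A * z ^+ r)%:E)%E.
  by rewrite lee_fin mulr_ge0 ?exprn_ge0.
apply: lime_le; first by apply: is_cvg_nneseries => r _.
apply: nearW => N; rewrite sumEFin lee_fin -mulr_sumr ler_wpM2l //.
have z1' : 0 < 1 - z by rewrite subr_gt0.
rewrite -[leRHS]mul1r ler_pdivlMr // big_mkord mulrC.
have -> : (1 - z) * (\sum_(i < N) z ^+ i) = 1 - z ^+ N.
  by rewrite -[RHS]opprB subrX1; ring.
by rewrite gerBl exprn_ge0.
Qed.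

Section spreading_time.
Variables (R : realType) (n : nat) (d : measure_display).
Variables (Omega : measurableType d) (P : probability Omega R).
Variable X : nat -> {RV P >-> informed n}.

Let T := spreading_time R X n.

Lemma spreading_time_ge0 w : (0 <= T w)%E.
Proof. by apply: le_ereal_inf_tmp => _ [t _ <-]; rewrite lee_fin. Qed.

Lemma spreading_time_gt t (r : R) w :
  t%:R <= r -> (r%:E < T w)%E -> (#|X t w| < n)%N.
Proof.
move=> tr; apply: contraTT; rewrite -leqNgt -leNgt => done.
apply: (@le_trans _ _ t%:R%:E); last by rewrite lee_fin.
by apply: ereal_inf_lbound; exists t.
Qed.

(** The infimum over a random set of times is rewritten as a countable infimum over all [t] of
    measurable functions, with value [+oo] at times when some node is still uninformed. *)
Lemma measurable_spreading_time : measurable_fun setT T.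
Proof.
pose f t w : \bar R := if (n <= #|X t w|)%N then t%:R%:E else +oo%E.
have -> : T = (fun w => einfs (f ^~ w) 0%N).
  apply/funext => w; apply/eqP; rewrite eq_le; apply/andP; split.
    apply: le_ereal_inf_tmp => _ [t _ <-]; rewrite /f.
    case: ifP => [done|_]; last by rewrite leey.
    by apply: ereal_inf_lbound; exists t.
  apply: le_ereal_inf_tmp => _ [t /= done <-].
  by apply: ereal_inf_lbound; exists t; rewrite //= /f done.
apply: measurable_fun_einfs => t.
apply: measurable_fun_ifT; [|exact: measurable_cst|exact: measurable_cst].
apply: (measurable_fun_bool true); rewrite setTI.
exact: (@measurable_state R n d Omega P X t (fun S => n <= #|S|)%N).
Qed.

(** Integrating [le_count_series] turns each threshold indicator into a tail probability;
    nonnegativity allows exchanging integral and series, and the tails are summed geometrically. *)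
Lemma expected_spreading_time_le (tau A z : R) : 0 <= A -> 0 <= z -> z < 1 ->
    0 <= tau ->
    (forall r : nat, (P [set w | (tau + r%:R)%:E < T w] <= (A * z ^+ r)%:E)%E) ->
  (\int[P]_w T w <= (tau + (1 + A / (1 - z)))%:E)%E.
Proof.
move=> A0 z0 z1 tau0 tail.
pose f (r : nat) w : \bar R := (((tau + r%:R)%:E < T w)%E : nat)%:R%:E.
have f0 r w : (0 <= f r w)%E by rewrite lee_fin.
have mA (r : nat) : measurable [set w | ((tau + r%:R)%:E < T w)%E].
  rewrite -[X in measurable X]setTI.
  exact: emeasurable_fun_o_infty measurable_spreading_time _.
have fE r : f r = EFin \o \1_[set w | ((tau + r%:R)%:E < T w)%E].
  by apply/funext => w; rewrite /f /= indicE mem_setE.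
have mf r : measurable_fun setT (f r).
  by rewrite fE; apply/measurable_EFinP; apply: measurable_indic.
have mseries : measurable_fun setT (fun w => \sum_(0 <= r <oo) f r w)%E.
  exact: ge0_emeasurable_sum.
apply: (@le_trans _ _ (\int[P]_w ((tau + 1)%:E + \sum_(0 <= r <oo) f r w))%E).
  apply: ge0_le_integral => //.
  - by move=> w _; apply: spreading_time_ge0.
  - exact: measurable_spreading_time.
  - by apply: emeasurable_funD.
  - by move=> w _; apply: le_count_series; apply: spreading_time_ge0.
rewrite ge0_integralD //; first last.
- by move=> w _; apply: nneseries_ge0.
- by move=> w _; rewrite lee_fin addr_ge0.
rewrite integral_cst // [X in ((_ + _)%:E * X)%E](_ : _ = 1%E); last exact: probability_setT.
rewrite mule1 integral_nneseries //.
rewrite addrA (EFinD (tau + 1)) leeD2l //.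
apply: le_trans (geometric_nneseries_le A0 z0 z1).
apply: lee_nneseries => [r _ _|r _]; first by apply: integral_ge0 => w _; apply: f0.
apply: le_trans (tail r); rewrite fE.
by rewrite (integral_indic P measurableT (mA r)) setIT.
Qed.

End spreading_time.

(* With [D2 = D * expR hi], each factor is at most [expR (- (rho - D2 / N))]; the
   loss [D2 / N] per round stays bounded over [ln N / rho] rounds. *)
Lemma tail_exponent (R : realType) (lo hi rho D kap N r : R) (t : nat) :
    0 < lo -> lo <= rho -> rho <= hi -> 0 <= D -> 1 <= N -> 0 <= r ->
    2 * (D * expR hi) / lo <= N ->
    rho^-1 * ln N + r - 1 <= t%:R ->
  N * ((expR (- rho) + D / N) ^+ t * expR kap) <=
  expR (kap + D * expR hi / lo + hi) * expR (- (lo / 2) * r).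
Proof.
move=> lo0 lor rhi D0 N1 r0 Nlarge ht.
have N0 : 0 < N by apply: lt_le_trans N1.
have rho0 : 0 < rho by apply: lt_le_trans lor.
set D2 := D * expR hi in Nlarge *.
have D20 : 0 <= D2 by rewrite mulr_ge0 ?expR_ge0.
have eps0 : 0 <= D2 / N by rewrite divr_ge0 // ltW.
(* The lower bound on [N] is chosen so that the perturbed rate [rho - D2 / N] stays at least
   [lo / 2]. *)
have eps : D2 / N <= lo / 2.
  rewrite ler_pdivrMr //; move: Nlarge; rewrite ler_pdivrMr //; lra.
have lamE : expR (- rho) + D / N <= expR (- (rho - D2 / N)).
  rewrite opprB addrC expRD.
  apply: (@le_trans _ _ (expR (- rho) * (1 + D2 / N))); last first.
    by rewrite mulrC ler_wpM2r ?expR_ge0 ?expR_ge1Dx.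
  rewrite mulrDr mulr1 addrC lerD2l mulrA ler_wpM2r ?invr_ge0 ?(ltW N0) //.
  rewrite /D2 mulrCA -expRD ler_peMr // -expR0 ler_expR; lra.
have lam0 : 0 <= expR (- rho) + D / N by rewrite addr_ge0 ?expR_ge0 ?divr_ge0 ?(ltW N0).
have := lerXn2r t lam0 (expR_ge0 _) lamE; rewrite -expRM_natl => lamt.
apply: (@le_trans _ _ (expR (ln N) * (expR (t%:R * - (rho - D2 / N)) * expR kap))).
  rewrite lnK // ler_wpM2l ?(ltW N0) // ler_wpM2r ?expR_ge0 //.
rewrite -!expRD ler_expR.
have lnN : ln N <= N by apply: ltW; apply: ln_sublinear.
have loss : D2 / N * (rho^-1 * ln N) <= D2 / lo.
  have -> : D2 / N * (rho^-1 * ln N) = D2 * (rho^-1 * (ln N / N)) by ring.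
  rewrite ler_wpM2l // -[leRHS]mulr1 ler_pM ?invr_ge0 ?(ltW rho0) //.
  - by rewrite divr_ge0 ?ln_ge0 // ltW.
  - by rewrite lef_pV2.
  - by rewrite ler_pdivrMr // mul1r.
have rhoinv : rho * (rho^-1 * ln N) = ln N by rewrite mulVKf // gt_eqF.
have d0 : 0 <= rho - D2 / N by lra.
(* The [- 1] in [ht] costs at most [rho <= hi] in the exponent, the term [ln N / rho] costs at most
   [D2 / lo] beyond cancelling [ln N], and [r] gains rate [lo / 2]. *)
have := ler_wpM2l d0 ht.
have : (lo / 2) * r <= (rho - D2 / N) * r by rewrite ler_wpM2r //; lra.
lra.
Qed.

(** * Choice of uniform constants and conclusion *)

Lemma card_setC_informed (n : nat) (S : informed n) :
  #|~: S| = (n - #|S|)%N.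
Proof.
apply: (@addnI #|S|); rewrite cardsC card_ord subnKC //.
by rewrite -[leqRHS]card_ord max_card.
Qed.

Unset Implicit Arguments.

Theorem theorem31 (R : realType) (rho : nat -> R) (g a c : R)
  (proc : forall n : nat, rumor_process R n)
  (rho_bounded : exists lo hi : R,
     0 < lo /\ 0 < hi /\ forall n : nat, lo <= rho n /\ rho n <= hi)
  (g_gt0 : 0 < g) (g_lt1 : g < 1) (a_ge0 : 0 <= a) (c_ge0 : 0 <= c)
  (shrink : exists q : R, q < 1 /\ forall n : nat, expR (- rho n) + a * g <= q)
  (conditions : exists n0 : nat, forall n : nat, (n0 <= n)%N ->
     forall u : nat, (1 <= u)%N -> u%:R <= g * n%:R ->
       1 - success_prob (proc n) (n - u) <= expR (- rho n) + a * (u%:R / n%:R)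
       /\ (covariance_number (proc n) (n - u) <= (c / u%:R)%:E)%E) :
  exists (C A' alpha' : R) (n1 : nat),
    0 < A' /\ 0 < alpha' /\
    forall n : nat, (n1 <= n)%N ->
    forall (d : measure_display) (Omega : measurableType d)
           (P : probability Omega R) (X : nat -> {RV P >-> informed n}),
      run_from (proc n) (n - Num.truncn (g * n%:R)) X ->
      (\int[P]_w spreading_time R X n w <= ((rho n)^-1 * ln n%:R + C)%:E)%E
      /\ forall r : nat,
           (P [set w | ((rho n)^-1 * ln n%:R + r%:R)%:E
                       < spreading_time R X n w]
            <= (A' * expR (- alpha' * r%:R))%:E)%E.
Proof.
have [lo [hi [lo0 [hi0 rhoB]]]] := rho_bounded.
have [q [q1 shrinkq]] := shrink.
have [n0 cond] := conditions.
(* As [rho n <= hi], this [b] satisfies [a <= b * expR (- rho n)] for all [n] at once, so [kap] and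
   all later constants are independent of [n]. *)
pose b := a * expR hi; pose kap := b / (1 - q).
have kapE : kap * (1 - q) = b by rewrite divfK // gt_eqF // subr_gt0.
have kap0 : 0 <= kap by rewrite divr_ge0 ?mulr_ge0 ?expR_ge0 // subr_ge0 ltW.
pose D := drift_error kap c.
have D0 : 0 <= D.
  rewrite /D /drift_error mulr_ge0 ?addr_ge0 // mulr_ge0 ?expR_ge0 //.
  by rewrite addr_ge0 // mulr_ge0 ?sqr_ge0 ?expR_ge0.
pose M := 2 * (D * expR hi) / lo.
have M0 : 0 <= M by rewrite divr_ge0 ?(ltW lo0) // mulr_ge0 // mulr_ge0 ?expR_ge0.
pose A := expR (kap + D * expR hi / lo + hi).
have A0 : 0 < A := expR_gt0 _.
pose z := expR (- (lo / 2)).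
have z0 : 0 <= z := expR_ge0 _.
have z1 : z < 1 by rewrite -expR0 ltr_expR oppr_lt0 divr_gt0.
(* The additive constant is the 1 of [le_count_series] plus the sum of the geometric tail. The
   successor in the threshold gives both [0 < n] and [M <= n]. *)
exists (1 + A / (1 - z)), A, (lo / 2), (maxn n0 (Num.truncn M).+1).
split=> //; split; first by rewrite divr_gt0.
move=> n; rewrite geq_max => /andP[n0n Mn] d Omega P X run.
have [lor rhi] := andP (introT andP (rhoB n)).
have n_gt0 : (0 < n)%N by apply: leq_trans Mn.
have N0 : 0 < n%:R :> R by rewrite ltr0n.
have N1 : 1 <= n%:R :> R by rewrite ler1n.
have Mn' : M <= n%:R.
  by apply/ltW/(lt_le_trans (truncnS_gt M)); rewrite ler_nat.
have rho0 : 0 < rho n by apply: lt_le_trans lor.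
pose s := expR (- rho n).
have s0 : 0 < s := expR_gt0 _.
have a_le : a <= b * s.
  by rewrite /b /s -mulrA -expRD ler_peMr // -expR0 ler_expR subr_ge0.
set tau := (rho n)^-1 * ln n%:R.
have tau0 : 0 <= tau by rewrite mulr_ge0 ?invr_ge0 ?(ltW rho0) // ln_ge0.
set k := (n - Num.truncn (g * n%:R))%N in run.
have gn0 : 0 <= g * n%:R by rewrite mulr_ge0 // ltW.
have gn_lt : (Num.truncn (g * n%:R) < n)%N.
  rewrite -(ltr_nat R); apply: (@le_lt_trans _ _ (g * n%:R)).
    by rewrite truncn_le.
  by rewrite gtr_pMl.
have k_gt0 : (0 < k)%N by rewrite subn_gt0.
(* At most [g * n] nodes are uninformed at every state the run can reach, so the hypotheses of the
   theorem apply in each round that has an uninformed node. *)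
have few (S : informed n) : (k <= #|S|)%N -> #|~: S|%:R <= g * n%:R.
  move=> kS; rewrite card_setC_informed.
  apply: (@le_trans _ _ (Num.truncn (g * n%:R))%:R); last by rewrite truncn_le.
  by rewrite ler_nat leq_subLR addnC -leq_subLR.
have drift (S : informed n) : (k <= #|S|)%N ->
    \sum_S' round_weight (proc n) S S' * potential kap S' <=
    (s + D / n%:R) * potential kap S.
  move=> kS; have S_few := few S kS.
  apply: (potential_drift n_gt0 a_ge0 c_ge0 s0 q1 a_le kapE kap0).
  - exact: leq_trans kS.
  - apply: le_trans (shrinkq n); rewrite lerD2l ler_wpM2l //.
    by rewrite /uninformed_frac ler_pdivrMr.
  - move=> u0; have := cond n n0n _ u0 S_few.
    by rewrite {1 3}card_setC_informed subKn // -[leqRHS]card_ord max_card.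
have tail (r : nat) : (P [set w | ((tau + r%:R)%:E < spreading_time R X n w)%E]
    <= (A * z ^+ r)%:E)%E.
  (* Rounding down keeps [t] below the threshold, as [spreading_time_gt] requires, and loses less
     than one round, the [- 1] allowed in [tail_exponent]. *)
  pose t := Num.truncn (tau + r%:R).
  have taur0 : 0 <= tau + r%:R by rewrite addr_ge0.
  have /andP[tle tgt] : t%:R <= tau + r%:R < t.+1%:R by apply: truncn_itv.
  apply: (@le_trans _ _ (P [set w | (#|X t w| < n)%N])).
    apply: le_measure; rewrite ?inE.
    - rewrite -[X in measurable X]setTI.
      exact: emeasurable_fun_o_infty (measurable_spreading_time X) _.
    - exact: (@measurable_state R n d Omega P X t (fun S => #|S| < n)%N).
    - by move=> w; apply: spreading_time_gt.
  have := @prob_stateE R n d Omega P X t (fun S => #|S| < n)%N.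
  rewrite /= => ->; rewrite lee_fin.
  (* Markov's inequality: [n] times the potential is at least 1 on every state with an uninformed
     node. *)
  apply: (@le_trans _ _ (n%:R * \sum_S state_law X t S * potential kap S)).
    rewrite mulr_sumr; apply: ler_sum => S _; rewrite mulrCA.
    rewrite ler_wpM2l ?state_law_ge0 //.
    have pot0 := potential_ge0 n_gt0 kap0 S.
    case: ltnP => Sn; last by rewrite mulr_ge0.
    apply: (@le_trans _ _ (n%:R * uninformed_frac R S)).
      rewrite /uninformed_frac mulrC divfK ?gt_eqF // ler1n.
      by rewrite card_setC_informed subn_gt0.
    by rewrite ler_pM2l // uninformed_frac_le_potential.
  have lam0 : 0 <= s + D / n%:R by rewrite addr_ge0 ?divr_ge0 ?(ltW s0).
  have start : \sum_S state_law X 0 S * potential kap S <= expR kap.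
    rewrite -[leRHS]mul1r -(state_law_sum1 X 0) mulr_suml.
    by apply: ler_sum => S _; rewrite ler_wpM2l ?state_law_ge0 // potential_le.
  apply: (@le_trans _ _ (n%:R * ((s + D / n%:R) ^+ t * expR kap))).
    rewrite ler_pM2l //; apply: (le_trans (state_law_drift run _ lam0 drift)).
    by rewrite ler_wpM2l // exprn_ge0.
  rewrite /z -expRM_natl (mulrC r%:R).
  apply: (tail_exponent kap lo0 lor rhi D0 N1 (ler0n _ r) Mn').
  by move: tgt; rewrite -natr1 /tau; lra.
split; first exact: expected_spreading_time_le (ltW A0) z0 z1 tau0 tail.
move=> r; apply: le_trans (tail r) _.
by rewrite /z -expRM_natl (mulrC r%:R).
Qed.
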